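(* A poset $P$ is a full semigroup poset if and only if there is a subsemigroup $T<\mathrm{End}(P)$ such that for every element $x\in P$ there is a unique $\varphi_x\in T$ such that $\varphi_x(P)=\,\uparrow\! x$.
   Context: For a semigroup $S$, define $t\leq_S t' :\iff \exists s\in S:\ ts=t'$ on $S$; when this is an order relation, $P(S,S)$ denotes the poset $(S,\leq_S)$. A poset $P$ is a full semigroup poset if $P\cong P(S,S)$ for some semigroup $S$ for which $\leq_S$ is an order relation. $\mathrm{End}(P)$ is the monoid of order endomorphisms (order-preserving self-maps) of $P$ under composition, and $\uparrow\! x=\{y\in P\mid x\leq y\}$ is the principal upset of $x$.
   Formalization: The subsemigroup T is additionally required to contain no elements other than the maps φ_x (every element of T has a principal upset as its image); without this the ''if'' direction fails, for example for a certain five-element poset. *)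

(* Defs.v *)
From HB Require Import structures.
From Corelib Require Import Relation_Definitions.
From mathcomp Require Import all_boot all_order.
From mathcomp Require Import boolp classical_sets.
Set Implicit Arguments.
Unset Strict Implicit.
Unset Printing Implicit Defensive.

Local Open Scope group_scope.

Definition semigroup_le (S : semigroupType) (t t' : S) : Prop :=
  exists s : S, t * s = t'.

(* In general [semigroup_le] need be neither reflexive nor antisymmetric.     *)
Definition full_semigroup_poset (d : Order.disp_t) (P : porderType d) : Prop :=
  exists S : semigroupType,
    Relation_Definitions.order S (@semigroup_le S) /\
    exists f : P -> S,
      bijective f /\
      forall x y : P, (x <= y)%O <-> semigroup_le (f x) (f y).

(* The empty set is accepted; this matters only for the empty poset, which is *)
(* likewise full in the sense above, semigroups being allowed to be empty.    *)
Definition subsemigroup_End (d : Order.disp_t) (P : porderType d)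
    (T : set {omorphism P -> P}) : Prop :=
  forall phi psi : {omorphism P -> P}, T phi -> T psi -> T (phi \o psi).

Definition upset (d : Order.disp_t) (P : porderType d) (x : P) : set P :=
  [set y | (x <= y)%O].

(* Main.v *)
Require Import Defs.
From HB Require Import structures.
From mathcomp Require Import all_boot all_order.
From mathcomp Require Import boolp classical_sets.

(** Transporting the semigroup along the isomorphism, [P] is a full semigroup
    poset if and only if it carries an associative product [m] such that
    [m x] has image [upset x] for every [x] ([full_semigroup_posetP]).  The
    theorem identifies such products with families of endomorphisms, [phi_x]
    being the left translation [m x].

    Left translations are monotone, since [y' = m y s] gives
    [m x y' = m (m x y) s], and they compose as the elements multiply;
    by antisymmetry, [x] is determined by the image of [m x].

    Conversely, given the [phi_x], put [m x y := phi_x y].  A monotone map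
    sends the least element [y] of [upset y] to the least element of the image,
    so the image of [phi_x \o phi_y], being a principal upset, can only be
    [upset (phi_x y)] ([range_comp_upset]).  By uniqueness
    [phi_x \o phi_y = phi_(phi_x y)], which is associativity of [m]. *)

Set Implicit Arguments.
Unset Strict Implicit.
Unset Printing Implicit Defensive.

Import Order.POrderTheory.

Lemma omorphism_ext (d d' : Order.disp_t) (P : porderType d)
    (Q : porderType d') (phi psi : {omorphism P -> Q}) :
  phi =1 psi -> phi = psi.
Proof.
case: phi psi => [f [[fP]]] [g [[gP]]] /= /funext fg.
by case: _ / fg gP => gP; rewrite (Prop_irrelevance fP gP).
Qed.

Lemma nondecreasing_omorphism (d d' : Order.disp_t) (P : porderType d)
    (Q : porderType d') (f : P -> Q) :
  {homo f : x y / (x <= y)%O} -> exists phi : {omorphism P -> Q}, phi =1 f.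
Proof.
move=> fP.
pose phi := HB.pack_for {omorphism P -> Q} f
  (@Order.isOrderMorphism.Build d P d' Q f fP).
by exists phi.
Qed.

Lemma mem_upset (d : Order.disp_t) (P : porderType d) (x : P) : upset x x.
Proof. exact: lexx. Qed.

Lemma upset_inj (d : Order.disp_t) (P : porderType d) :
  injective (@upset d P).
Proof.
move=> x y xy; apply: le_anti; apply/andP; split.
- by have := mem_upset y; rewrite -xy.
- by have := mem_upset x; rewrite xy.
Qed.

Lemma range_comp_upset (d : Order.disp_t) (P : porderType d)
    (phi psi : {omorphism P -> P}) (y z : P) :
  range psi = upset y -> range (phi \o psi) = upset z -> z = phi y.
Proof.
move=> psiy compz; apply: le_anti; apply/andP; split.
- have [w _ wy] : range psi y by rewrite psiy; exact: mem_upset.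
  have : range (phi \o psi) (phi y) by exists w; rewrite //= wy.
  by rewrite compz.
- have [w _ <-] : range (phi \o psi) z by rewrite compz; exact: mem_upset.
  apply: Order.OrderMorphismTheory.omorph_le.
  have : range psi (psi w) by exists w.
  by rewrite psiy.
Qed.

(** The type [T] as a semigroup with product [m]; the associativity proof is a
    parameter of the type so that the canonical instance can depend on it. *)
Definition semigroup_of (T : choiceType) (m : T -> T -> T)
  (mA : associative m) : Type := T.

HB.instance Definition _ (T : choiceType) (m : T -> T -> T)
  (mA : associative m) := Choice.on (semigroup_of mA).
HB.instance Definition _ (T : choiceType) (m : T -> T -> T)
  (mA : associative m) := isSemigroup.Build (semigroup_of mA) mA.

Lemma full_semigroup_posetP (d : Order.disp_t) (P : porderType d) :
  full_semigroup_poset P <->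
  exists m : P -> P -> P,
    associative m /\ forall x, range (m x) = upset x.
Proof.
split=> [[S [_ [f [[g fK gK] fle]]]]|[m [mA mP]]].
- exists (fun x y => g (f x * f y)%g); split.
    by move=> x y z; rewrite !gK mulgA.
  move=> x; apply/seteqP; split=> y.
    by case=> s _ <-; apply/fle; rewrite gK; exists (f s).
  by move=> /fle[s xs]; exists (g s); rewrite // gK xs fK.
- pose S : semigroupType := semigroup_of mA.
  have leE (x y : P) : (x <= y)%O <-> @semigroup_le S x y.
    have -> : ((x <= y)%O : Prop) = range (m x) y by rewrite mP.
    by split=> [[s _ <-]|[s <-]]; exists s.
  exists S; split; last by exists id; split; first exists id.
  split=> [x|x y z /leE xy /leE yz|x y /leE xy /leE yx].
  + by apply/leE.
  + by apply/leE/(le_trans xy yz).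
  + by apply: le_anti; rewrite xy yx.
Qed.

(* The subsemigroup T is the family of the phi_x: the last clause says that T
   has no further elements.  Without it the backward implication fails, e.g.
   for the poset on {a, b, c, d, e} with a < c, d, e and b < d, e. *)
Theorem corollary2p5 (d : Order.disp_t) (P : porderType d) :
  full_semigroup_poset P <->
  exists T : set {omorphism P -> P},
    [/\ subsemigroup_End T,
        (forall x : P,
           exists! phi : {omorphism P -> P}, T phi /\ range phi = upset x)
      & (forall phi : {omorphism P -> P},
           T phi -> exists x : P, range phi = upset x)].
Proof.
rewrite full_semigroup_posetP; split=> [[m [mA mP]]|[T [TM Tuniq Tupset]]].
- exists [set phi : {omorphism P -> P} | exists x, phi =1 m x]%classic; split.
  + move=> phi psi [x phix] [y psiy]; exists (m x y) => z /=.
    by rewrite phix psiy mA.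
  + move=> x; have [phi phix] : exists phi : {omorphism P -> P}, phi =1 m x.
      apply: nondecreasing_omorphism => y y'.
      rewrite -[is_true _]/(upset y y') -mP => -[s _ <-].
      rewrite -[is_true _]/(upset _ _) -mP.
      by exists s; rewrite // mA.
    exists phi; split; first by split; [exists x|rewrite (funext phix)].
    move=> psi [[y psiy]]; rewrite (funext psiy) mP => /upset_inj yx.
    by apply: omorphism_ext => z; rewrite phix psiy yx.
  + by move=> phi [x phix]; exists x; rewrite (funext phix).
- have [phi phiP] := choice Tuniq.
  have Tphi x : T (phi x) by have [[]] := phiP x.
  have rphi x : range (phi x) = upset x by have [[]] := phiP x.
  exists (fun x y => phi x y); split=> // x y z.
  have Txy : T (phi x \o phi y) by exact: TM.
  have [w wP] := Tupset _ Txy.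
  have wE := range_comp_upset (rphi y) wP; rewrite wE in wP.
  have [_ /(_ _ (conj Txy wP)) ->] := phiP (phi x y).
  by [].
Qed.
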